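(* Let $2\le r<n$ and let $X_1,\dots,X_n$ be random variables with one-dimensional cdf's $F_1,\dots,F_n$ whose joint cdf is absolutely continuous with respect to $\prod_{k=1}^nF_k(x_k)$. Let $\xi_1,\dots,\xi_n$ be independent random variables with cdf's $F_1,\dots,F_n$, and let $g_{i_1,\dots,i_c}$ be the canonical functions of the joint distribution of $X_1,\dots,X_n$. Then $X_1,\dots,X_n$ are $r$-independent if and only if $$g_{i_1,\dots,i_c}(\xi_{i_1},\dots,\xi_{i_c})=0\ \text{(a.s.)}\quad\text{for all }1\le i_1<\dots<i_c\le n,\ c=2,\dots,r.$$
   Context: Random variables $X_1,\dots,X_n$ are called $r$-independent ($2\le r<n$) if any $r$ of them are jointly independent. Canonical functions: if the joint cdf $F$ of $X_1,\dots,X_n$ is absolutely continuous with respect to the product of its marginals, i.e. $F(x_1,\dots,x_n)=\int_{-\infty}^{x_1}\cdots\int_{-\infty}^{x_n}G\,dF_1\cdots dF_n$ for some Borel $G\ge0$, then there exist Borel functions $g_{i_1,\dots,i_c}:\mathbf R^c\to\mathbf R$, $1\le i_1<\dots<i_c\le n$, $c=2,\dots,n$, with: (A1) $E|g_{i_1,\dots,i_c}(\xi_{i_1},\dots,\xi_{i_c})|<\infty$; (A2) $E(g_{i_1,\dots,i_c}(\xi_{i_1},\dots,\xi_{i_c})\mid\xi_{i_1},\dots,\xi_{i_{k-1}},\xi_{i_{k+1}},\dots,\xi_{i_c})=0$ (a.s.) for $k=1,\dots,c$; (A3) $U_n(\xi_1,\dots,\xi_n):=\sum_{c=2}^n\sum_{1\le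 i_1<\dots<i_c\le n}g_{i_1,\dots,i_c}(\xi_{i_1},\dots,\xi_{i_c})\ge-1$ (a.s.); and $$F(x_1,\dots,x_n)=\int_{-\infty}^{x_1}\cdots\int_{-\infty}^{x_n}(1+U_n(t_1,\dots,t_n))\prod_{i=1}^ndF_i(t_i).$$ The random variables $g_{i_1,\dots,i_c}(\xi_{i_1},\dots,\xi_{i_c})$ are a.s. uniquely determined by $F$. These $g_{i_1,\dots,i_c}$ are called here the canonical functions of the joint distribution. *)

(* Defs.v *)
From HB Require Import structures.
From mathcomp Require Import all_boot all_order all_algebra.
From mathcomp Require Import all_classical all_reals all_analysis.

Set Implicit Arguments.
Unset Strict Implicit.
Unset Printing Implicit Defensive.

Import Order.TTheory GRing.Theory Num.Theory.
Import numFieldNormedType.Exports.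

Local Open Scope classical_set_scope.
Local Open Scope ring_scope.

Section independence.
Context (d : measure_display) (T : measurableType d) (R : realType).
Variables (P : probability T R) (n : nat) (X : 'I_n -> {RV P >-> R}).

(* The events B i may be taken to be the whole line, so the product rule
   for subfamilies of J is included. *)
Definition jointly_independent (J : {set 'I_n}) : Prop :=
  forall B : 'I_n -> set R, (forall i, measurable (B i)) ->
  (P [set w | forall i, i \in J -> B i (X i w)] =
     \prod_(i in J) P (X i @^-1` B i))%E.

Definition r_independent (r : nat) : Prop :=
  forall J : {set 'I_n}, #|J| = r -> jointly_independent J.

Definition joint_cdf (x : n.-tuple R) : \bar R :=
  P [set w | forall i, X i w <= tnth x i].

Definition random_vector (w : T) : n.-tuple R := [tuple X i w | i < n].

Definition sigma_of (J : {set 'I_n}) : set (set T) :=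
  g_sigma_preimage (fun k : 'I_#|J| => X (enum_val k) : T -> R).

End independence.

(* Z is a version of E(Y | G). *)
Definition is_cond_expectation (d : measure_display) (T : measurableType d)
    (R : realType) (P : probability T R) (G : set (set T)) (Y Z : T -> R) :
    Prop :=
  [/\ P.-integrable setT (EFin \o Y),
      P.-integrable setT (EFin \o Z),
      (forall B : set R, measurable B -> G (Z @^-1` B)) &
      forall S, G S ->
        (\int[P]_(w in S) (Z w)%:E = \int[P]_(w in S) (Y w)%:E)%E].

(* int_{-oo}^{x_0} ... int_{-oo}^{x_{n-1}} f(t_0, ..., t_{n-1})
     dF_{n-1}(t_{n-1}) ... dF_0(t_0), as iterated Lebesgue-Stieltjes integrals *)
Fixpoint iterated_integral (R : realType) (n : nat) :
    ('I_n -> cumulativeBounded (0 : R) (1 : R)) -> n.-tuple R ->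
    (n.-tuple R -> \bar R) -> \bar R :=
  match n with
  | 0%N => fun _ _ f => f [tuple]
  | n'.+1 => fun F x f =>
      (\int[lebesgue_stieltjes_measure (F ord0)]_(t in `]-oo, thead x])
         iterated_integral (fun i => F (lift ord0 i)) [tuple of behead x]
           (fun u => f [tuple of t :: u]))%E
  end.

Definition abs_continuous_cdf (R : realType) (n : nat)
    (F : 'I_n -> cumulativeBounded (0 : R) (1 : R)) (H : n.-tuple R -> \bar R) :
    Prop :=
  exists G : n.-tuple R -> R,
    [/\ measurable_fun setT G, (forall t, 0 <= G t) &
        forall x, H x = iterated_integral F x (EFin \o G)].

(* The indices i_1 < ... < i_c are encoded by the set A = {i_1, ..., i_c};
   enum_val lists the elements of A in increasing order. *)
Definition subvector (R : realType) (n : nat) (A : {set 'I_n})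
    (t : n.-tuple R) : #|A|.-tuple R :=
  [tuple tnth t (enum_val k) | k < #|A|].

(* Families indexed by all sets A; only the members with 2 <= #|A| matter. *)
Definition fun_family (R : realType) (n : nat) :=
  forall A : {set 'I_n}, #|A|.-tuple R -> R.

Definition canonical_sum (R : realType) (n : nat) (g : fun_family R n)
    (t : n.-tuple R) : R :=
  \sum_(A : {set 'I_n} | (2 <= #|A|)%N) g A (subvector A t).

Record canonical_functions (R : realType) (n : nat)
    (F : 'I_n -> cumulativeBounded (0 : R) (1 : R)) (H : n.-tuple R -> \bar R)
    (d : measure_display) (T : measurableType d) (Q : probability T R)
    (xi : 'I_n -> {RV Q >-> R}) (g : fun_family R n) : Prop := {
  canonical_borel : forall A : {set 'I_n}, (2 <= #|A|)%N ->
    measurable_fun setT (g A);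
  canonical_A1 : forall A : {set 'I_n}, (2 <= #|A|)%N ->
    (\int[Q]_w `|g A (subvector A (random_vector xi w))|%:E < +oo)%E;
  canonical_A2 : forall A : {set 'I_n}, (2 <= #|A|)%N ->
    forall i, i \in A ->
      is_cond_expectation Q (sigma_of xi (A :\ i))
        (fun w => g A (subvector A (random_vector xi w))) (cst 0);
  canonical_A3 :
    {ae Q, forall w, -1 <= canonical_sum g (random_vector xi w)};
  canonical_representation : forall x,
    H x = iterated_integral F x (fun t => (1 + canonical_sum g t)%:E)
}.

(* Main.v *)
(* Idea.  By Fubini and independence of the xi_i, the representation of the joint
   cdf says that the law of X has density 1 + U_n with respect to the law of xi:
   two finite signed measures that have the same total mass and agree on the
   orthants {t | t_i <= x_i for all i} coincide.  Integrating the density over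
   {xi_j in B_j, j in J} kills every g_A with A not included in J, since such a
   g_A has conditional mean zero given any n - 1 coordinates that omit some
   i in A \ J.  Hence
     P(X_j in B_j, j in J) = prod_(j in J) P(X_j in B_j)
       + sum_(A included in J, 2 <= #|A|) int_(xi_j in B_j, j in J) g_A(xi_A) dQ.
   If all g_A with #|A| <= r vanish, this is r-independence.  Conversely, by
   induction on #|A| only the term A = J survives in the sum for J = A, so
   g_A(xi_A) integrates to 0 over all rectangles, hence vanishes a.s. *)
Require Import Defs.
From HB Require Import structures.
From mathcomp Require Import all_boot all_order all_algebra.
From mathcomp Require Import all_classical all_reals all_analysis.
From mathcomp Require Import measurable_realfun.
Import Order.TTheory GRing.Theory Num.Theory.
Import numFieldNormedType.Exports.
Local Open Scope classical_set_scope.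
Local Open Scope ring_scope.

(** * Orthants and laws of random vectors *)

Definition orthant {R : realType} {n : nat} (x : n.-tuple R) :
  set (n.-tuple R) := [set t | forall i, tnth t i <= tnth x i].

Lemma measurable_rectangle {R : realType} {n : nat} (J : {set 'I_n})
    (B : 'I_n -> set R) : (forall i, measurable (B i)) ->
  measurable [set t : n.-tuple R | forall i, i \in J -> B i (tnth t i)].
Proof.
move=> mB.
have -> : [set t : n.-tuple R | forall i, i \in J -> B i (tnth t i)] =
    \bigcap_(i in [set` J]) ((fun t : n.-tuple R => tnth t i) @^-1` B i).
  by apply/seteqP; split=> t /= Bt i; exact: Bt.
apply: fin_bigcap_measurable; first exact: finite_finset.
by move=> i _; rewrite -[X in measurable X]setTI; exact: measurable_tnth.
Qed.

Lemma orthant_rectangle {R : realType} {n : nat} (x : n.-tuple R) :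
  orthant x = [set t | forall i, i \in [set: 'I_n]%SET ->
                       `]-oo, tnth x i]%classic (tnth t i)].
Proof.
apply/seteqP; split=> t /= xt i; first by rewrite in_itv /= xt.
by have := xt i; rewrite in_itv/=; apply; rewrite finset.in_setT.
Qed.

Lemma measurable_orthant {R : realType} {n : nat} (x : n.-tuple R) :
  measurable (orthant x).
Proof.
rewrite orthant_rectangle.
exact: (measurable_rectangle _ (fun i => `]-oo, tnth x i]%classic)).
Qed.

Lemma setI_closed_orthant {R : realType} {n : nat} :
  setI_closed (range (@orthant R n)).
Proof.
move=> _ _ [x _ <-] [y _ <-].
exists [tuple Num.min (tnth x i) (tnth y i) | i < n] => //.
apply/seteqP; split=> [t /= xyt|t [/= xt yt] i].
  by split=> i; have := xyt i; rewrite tnth_mktuple le_min => /andP[].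
by rewrite tnth_mktuple le_min xt yt.
Qed.

(** It suffices that every coordinate is measurable for the sigma-algebra generated by the orthants.
    An orthant bounds all coordinates at once, so a half-space in one coordinate is reached as a
    countable union of orthants. *)
Lemma measurable_orthants {R : realType} {n : nat} :
  @measurable _ (n.-tuple R) = <<s range (@orthant R n) >>.
Proof.
apply/seteqP; split; last first.
  apply: smallest_sub; first exact: sigma_algebra_measurable.
  by move=> _ [x _ <-]; exact: measurable_orthant.
pose T := g_sigma_algebraType (range (@orthant R n)).
have mtnth i : measurable_fun [set: T] (fun t : T => tnth (t : n.-tuple R) i).
  apply: (measurability _ (RGenOInfty.measurableE R)) => _ [_ [y ->] <-].
  (* The complementary half-space [t_i <= y] is exhausted by orthants with bound [y] at [i] and
     bound [k] at every other coordinate. *)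
  have -> : [set: T] `&` (fun t : T => tnth (t : n.-tuple R) i) @^-1` `]y, +oo[ =
      ~` \bigcup_(k : nat) orthant [tuple if j == i then y else k%:R | j < n].
    apply/seteqP; split=> [t /= [_]|t /= nt].
      rewrite in_itv/= andbT => yt [k _ /= /(_ i)].
      by rewrite tnth_mktuple eqxx leNgt yt.
    split=> //; rewrite in_itv/= andbT ltNge; apply/negP => ty; apply: nt.
    (* This natural number exceeds the absolute value of every coordinate of [t]. *)
    exists (\max_(j < n) Num.truncn `|tnth (t : n.-tuple R) j|).+1%N => //= j.
    rewrite tnth_mktuple; case: eqP => [->//|_].
    apply: (le_trans (ler_norm _)); apply: ltW.
    apply: (lt_le_trans (truncnS_gt _)).
    by rewrite ler_nat ltnS; exact: (leq_bigmax j).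
  apply: sigma_algebraC; apply: sigma_algebra_bigcup => k.
  by apply: sub_sigma_algebra; eexists.
apply: smallest_sub; first exact: smallest_sigma_algebra.
rewrite -bigcup_seq => A [i _ /= [B mB <-]].
exact: mtnth.
Qed.

(** Dynkin's pi-lambda argument: the orthants are closed under intersection and generate, and the
    good sets form a lambda-system, equal total mass giving complements. Charges are used because
    the set functions to be compared include integrals of functions of varying sign; [Y] and [Z] may
    live on different spaces. *)
Lemma charge_orthant_unique {R : realType} {n : nat} {d d'}
    {T : measurableType d} {T' : measurableType d'}
    (mu : {charge set T -> \bar R}) (nu : {charge set T' -> \bar R})
    (Y : T -> n.-tuple R) (Z : T' -> n.-tuple R) :
  measurable_fun setT Y -> measurable_fun setT Z ->
  mu setT = nu setT ->
  (forall x, mu (Y @^-1` orthant x) = nu (Z @^-1` orthant x)) ->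
  forall C, measurable C -> mu (Y @^-1` C) = nu (Z @^-1` C).
Proof.
move=> mY mZ munuT munux C; rewrite measurable_orthants.
have mYC S : measurable S -> measurable (Y @^-1` S).
  by move=> mS; rewrite -[X in measurable X]setTI; exact: mY.
have mZC S : measurable S -> measurable (Z @^-1` S).
  by move=> mS; rewrite -[X in measurable X]setTI; exact: mZ.
apply: (@dynkin_induction _ _ (range (@orthant R n))
  (fun C => mu (Y @^-1` C) = nu (Z @^-1` C))).
- exact: measurable_orthants.
- exact: setI_closed_orthant.
- by rewrite !preimage_setT.
- by move=> _ [x _ <-].
- move=> S mS munuS.
  have -> : Y @^-1` (~` S) = setT `\` Y @^-1` S by rewrite setTD.
  have -> : Z @^-1` (~` S) = setT `\` Z @^-1` S by rewrite setTD.
  rewrite (chargeD mu measurableT (mYC _ mS)) (chargeD nu measurableT (mZC _ mS)).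
  by rewrite !setTI munuT munuS.
- move=> F mF tF munuF; rewrite !preimage_bigcup.
  have tP V W (f : V -> W) (G : (set W)^nat) :
      trivIset setT G -> trivIset setT (fun k => f @^-1` G k).
    move=> /trivIsetP tG; apply/trivIsetP => i j _ _ ij.
    by rewrite -preimage_setI tG// preimage_set0.
  have /cvg_lim <- // := @charge_semi_sigma_additive _ _ _ mu
    (fun k => Y @^-1` F k) (fun k => mYC _ (mF k)) (tP _ _ _ _ tF)
    (bigcup_measurable (fun k _ => mYC _ (mF k))).
  have /cvg_lim <- // := @charge_semi_sigma_additive _ _ _ nu
    (fun k => Z @^-1` F k) (fun k => mZC _ (mF k)) (tP _ _ _ _ tF)
    (bigcup_measurable (fun k _ => mZC _ (mF k))).
  by under eq_fun do under eq_bigr do rewrite munuF.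
Qed.

Lemma eq_law_integral {R : realType} {d d' d0}
    {T : measurableType d} {T' : measurableType d'} {U : measurableType d0}
    (mu : {measure set T -> \bar R}) (nu : {measure set T' -> \bar R})
    (Y : T -> U) (Z : T' -> U) (f : U -> \bar R) :
  measurable_fun setT Y -> measurable_fun setT Z -> measurable_fun setT f ->
  (forall C, measurable C -> mu (Y @^-1` C) = nu (Z @^-1` C)) ->
  (\int[mu]_w f (Y w) = \int[nu]_w f (Z w))%E.
Proof.
move=> mY mZ mf munu.
have ge0 (h : U -> \bar R) : measurable_fun setT h -> (forall u, 0 <= h u)%E ->
    (\int[mu]_w h (Y w) = \int[nu]_w h (Z w))%E.
  move=> mh h0.
  have := ge0_integral_pushforward mY mu measurableT mh (fun u _ => h0 u).
  have := ge0_integral_pushforward mZ nu measurableT mh (fun u _ => h0 u).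
  rewrite !preimage_setT => <- <-.
  by apply: eq_measure_integral => C mC _; exact: munu.
rewrite [LHS]integralE [RHS]integralE; congr (_ - _)%E.
- under eq_integral do rewrite funepos_comp/=.
  under [in RHS]eq_integral do rewrite funepos_comp/=.
  by apply: ge0 => //; exact: measurable_funepos.
- under eq_integral do rewrite funeneg_comp/=.
  under [in RHS]eq_integral do rewrite funeneg_comp/=.
  by apply: ge0 => //; exact: measurable_funeneg.
Qed.

(** * Iterated integrals *)

(** Tonelli's measurability statement is applied to the positive and negative parts, after [D] has
    been absorbed into the integrand. *)
Lemma measurable_fun_parametric_integral {d1 d2} {S : measurableType d1}
    {T : measurableType d2} {R : realType}
    (m : {sigma_finite_measure set T -> \bar R}) (D : set T)
    (f : (S * T)%type -> \bar R) :
  measurable D -> measurable_fun [set: S * T] f ->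
  measurable_fun setT (fun s => \int[m]_(t in D) f (s, t))%E.
Proof.
move=> mD mf; pose g := f \_ (setT `*` D).
have mg : measurable_fun setT g.
  apply/measurable_restrict => //; first exact: measurableX.
  exact: measurable_funTS.
have -> : (fun s => \int[m]_(t in D) f (s, t))%E =
    ((fun s => \int[m]_t g^\+ (s, t)) \- (fun s => \int[m]_t g^\- (s, t)))%E.
  apply/funext => s; transitivity (\int[m]_t g (s, t))%E.
    rewrite integral_mkcond; apply: eq_integral => t _.
    by rewrite /g !patchE in_setX (in_setT s).
  rewrite [LHS]integralE; under eq_integral do rewrite funepos_comp/=.
  by under [X in (_ - X)%E = _]eq_integral do rewrite funeneg_comp/=.
apply: emeasurable_funB; apply: measurable_fun_fubini_tonelli_F => //.
- exact: measurable_funepos.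
- exact: measurable_funeneg.
Qed.

(** The parameter space [S] is there for the induction on [n]: the outermost integration variable
    joins the parameters, so the induction hypothesis is used for the product of [S] with the
    line. *)
Lemma measurable_iterated_integral {R : realType} {n : nat}
    {d} {S : measurableType d} (F : 'I_n -> cumulativeBounded (0 : R) (1 : R))
    (x : n.-tuple R) (f : S * n.-tuple R -> \bar R) :
  measurable_fun setT f ->
  measurable_fun setT (fun s => iterated_integral F x (fun u => f (s, u))).
Proof.
elim: n d S F x f => [|n IH] d S F x f mf /=.
  apply: (measurableT_comp mf (g := fun s => (s, [tuple]))).
  exact: measurable_fun_pair.
pose f' (z : S * measurableTypeR R * n.-tuple R) : \bar R :=
  f (z.1.1, [tuple of (z.1.2 : R) :: z.2]).
have mid : measurable_fun setT (idfun : measurableTypeR R -> R).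
  exact: (@measurable_id _ _ setT).
have mf' : measurable_fun setT f'.
  apply: (measurableT_comp mf (g := fun z : S * measurableTypeR R * n.-tuple R =>
    (z.1.1, [tuple of (z.1.2 : R) :: z.2]))).
  apply: measurable_fun_pair; first exact: measurableT_comp.
  apply: measurable_cons => //.
  apply: (measurableT_comp mid (g := fun z => z.1.2)).
  exact: measurableT_comp.
pose g z := iterated_integral (fun i => F (lift ord0 i)) [tuple of behead x]
  (fun u => f' (z, u)).
apply: (@measurable_fun_parametric_integral _ _ _ _ _
  (lebesgue_stieltjes_measure (F ord0)) _ g); first exact: measurable_itv.
exact: IH.
Qed.

Lemma orthant_cons {R : realType} {n : nat} (x : n.+1.-tuple R) (t : R)
    (u : n.-tuple R) :
  orthant x [tuple of t :: u] <->
  `]-oo, thead x]%classic t /\ orthant [tuple of behead x] u.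
Proof.
rewrite [x in orthant x](tuple_eta x) /= in_itv /=; split=> [xtu|[tx ux] i].
  by split=> [|i]; [have := xtu ord0; rewrite !tnth0|
    have := xtu (lift ord0 i); rewrite !tnthS].
by case: (unliftP ord0 i) => [j|] ->; rewrite ?tnthS ?tnth0//; exact: ux.
Qed.

Lemma orthantE {R : realType} {n : nat} (x : n.-tuple R) :
  orthant x = [set t | forall i, `]-oo, tnth x i]%classic (tnth t i)].
Proof.
by apply/seteqP; split=> t /= xt i; have := xt i; rewrite in_itv.
Qed.

(** Fubini, one coordinate at a time. In the induction [Q] stays fixed and [Y] is replaced by its
    tail, so a single product with the law of the first coordinate is formed at each step. *)
Lemma iterated_integral_independent {R : realType} {n : nat} {d}
    {T : measurableType d} (Q : probability T R)
    (F : 'I_n -> cumulativeBounded (0 : R) (1 : R)) (Y : T -> n.-tuple R)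
    (x : n.-tuple R) (f : n.-tuple R -> \bar R) :
  measurable_fun setT Y ->
  (forall B : 'I_n -> set R, (forall i, measurable (B i)) ->
    Q [set w | forall i, B i (tnth (Y w) i)] =
    \prod_(i < n) lebesgue_stieltjes_measure (F i) (B i))%E ->
  measurable_fun setT f -> Q.-integrable setT (f \o Y) ->
  iterated_integral F x f = (\int[Q]_(w in Y @^-1` orthant x) f (Y w))%E.
Proof.
elim: n F Y x f => [|n IH] F Y x f mY indY mf intf /=.
  have -> : Y @^-1` orthant x = setT by apply/seteqP; split=> // w _ [].
  under eq_integral do rewrite tuple0.
  transitivity (f [tuple] * Q setT)%E; first by rewrite (@probability_setT _ _ _ Q) mule1.
  by rewrite -(integral_cst Q measurableT).
pose m : probability (measurableTypeR R) R := lebesgue_stieltjes_measure (F ord0).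
pose F' i := F (lift ord0 i).
pose Y' w : n.-tuple R := [tuple of behead (Y w)].
pose x' : n.-tuple R := [tuple of behead x].
(* [Z] replaces the first coordinate of [Y] by a copy on its own factor of a product space; it has
   the law of [Y], and Fubini applies to it. *)
pose Z (z : measurableTypeR R * T) : n.+1.-tuple R := [tuple of (z.1 : R) :: Y' z.2].
have mid : measurable_fun setT (idfun : measurableTypeR R -> R).
  exact: (@measurable_id _ _ setT).
have mY' : measurable_fun setT Y'.
  exact: (measurableT_comp (@measurable_behead _ _ n) mY).
have mZ : measurable_fun setT Z.
  apply: measurable_cons; first exact: (measurableT_comp mid measurable_fst).
  exact: measurableT_comp.
have indY' (B : 'I_n -> set R) : (forall i, measurable (B i)) ->
    Q [set w | forall i, B i (tnth (Y' w) i)] =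
    (\prod_(i < n) lebesgue_stieltjes_measure (F' i) (B i))%E.
  move=> mB.
  (* Leaving the first coordinate free turns the product rule for [Y] into that for its tail. *)
  pose B0 i := if unlift ord0 i is Some j then B j else setT.
  have mB0 i : measurable (B0 i) by rewrite /B0; case: unlift.
  have := indY B0 mB0.
  have mB1 : lebesgue_stieltjes_measure (F ord0) (B0 ord0) = 1%E.
    by rewrite /B0 unlift_none; exact: (probability_setT m).
  rewrite big_ord_recl mB1 mul1e.
  under eq_bigr do rewrite /B0 liftK.
  move=> <-; congr (Q _); apply/seteqP; split=> w /= Bw i.
    case: (unliftP ord0 i) => [j|] ->; rewrite /B0 ?liftK ?unlift_none//.
    by rewrite (tuple_eta (Y w)) tnthS; exact: Bw.
  by have := Bw (lift ord0 i); rewrite /B0 liftK [in tnth (Y w)](tuple_eta (Y w)) tnthS.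
have QY y : Q (Y @^-1` orthant y) =
    (\prod_(i < n.+1) lebesgue_stieltjes_measure (F i) `]-oo, tnth y i])%E.
  rewrite orthantE.
  by apply: (indY (fun i => `]-oo, tnth y i]%classic)) => i; exact: measurable_itv.
have QY' (y : n.-tuple R) : Q (Y' @^-1` orthant y) =
    (\prod_(i < n) lebesgue_stieltjes_measure (F' i) `]-oo, tnth y i])%E.
  rewrite orthantE.
  by apply: (indY' (fun i => `]-oo, tnth y i]%classic)) => i; exact: measurable_itv.
have ZY C : measurable C -> (m \x Q)%E (Z @^-1` C) = Q (Y @^-1` C).
  pose mu : {charge set (measurableTypeR R * T)%type -> \bar R} := charge_of_finite_measure
    (product_subprobability (m : subprobability _ R, Q : subprobability _ R)).
  have H := charge_orthant_unique mu (charge_of_finite_measure Q) Z Y mZ mY.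
  have muE A : mu A = (m \x Q)%E A by [].
  rewrite -muE; move: C; apply: H.
    rewrite /charge_of_finite_measure /= -setXTT product_measure1E//.
    by rewrite -[RHS]mul1e; congr (_ * _)%E; exact: (probability_setT m).
  move=> y; rewrite /charge_of_finite_measure /=.
  pose y' : n.-tuple R := [tuple of behead y].
  have -> : Z @^-1` orthant y = `]-oo, thead y]%classic `*` (Y' @^-1` orthant y').
    by apply/seteqP; split=> -[t w] /= /orthant_cons.
  rewrite product_measure1E//; first last.
  - rewrite -[X in measurable X]setTI; apply: mY' => //.
    exact: measurable_orthant.
  rewrite QY big_ord_recl; congr (_ * _)%E.
  apply: (etrans (QY' y')); apply: eq_bigr => i _.
  by rewrite [in RHS](tuple_eta y) tnthS.
(* With the orthant moved into the integrand, both integrals run over whole spaces and depend only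
   on the common law of [Y] and [Z]. *)
pose G := f \_ (orthant x).
have mG : measurable_fun setT G.
  apply/measurable_restrict => //; first exact: measurable_orthant.
  exact: measurable_funTS.
have mYx : measurable (Y @^-1` orthant x).
  by rewrite -[X in measurable X]setTI; apply: mY => //; exact: measurable_orthant.
have intZ h : measurable_fun setT h -> Q.-integrable setT (h \o Y) ->
    (m \x Q)%E.-integrable setT (h \o Z).
  move=> mh /integrableP[_ hoo]; apply/integrableP; split.
    exact: measurableT_comp.
  rewrite (eq_law_integral _ _ Z Y (fun u => `|h u|%E) mZ mY _ ZY)//.
  exact: measurableT_comp.
have intGY : Q.-integrable setT (G \o Y).
  have -> : G \o Y = (f \o Y) \_ (Y @^-1` orthant x) by [].
  apply: (integrable_mkcond (f \o Y) mYx).1.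
  exact: (integrableS measurableT mYx _ intf).
have -> : (\int[Q]_(w in Y @^-1` orthant x) f (Y w))%E = (\int[Q]_w G (Y w))%E.
  by rewrite integral_mkcond.
rewrite -(eq_law_integral _ _ Z Y G mZ mY mG ZY).
rewrite -[RHS](integral12_prod_meas1 (intZ _ mG intGY)) [LHS]integral_mkcond.
(* The induction hypothesis requires the section of [f] at [t] to be integrable, which Fubini
   provides only for almost every [t]. *)
apply: ae_eq_integral => //.
- apply/measurable_restrict => //.
  apply: measurable_funTS.
  apply: (measurable_iterated_integral F' x'
    (fun z : measurableTypeR R * n.-tuple R => f [tuple of (z.1 : R) :: z.2])).
  apply: (measurableT_comp mf).
  by apply: measurable_cons => //; exact: (measurableT_comp mid).
- exact: measurable_fubini_F (intZ _ mG intGY).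
- have := ae_integrable1 (intZ _ mf intf).
  apply: filterS => t intt _.
  rewrite /fubini_F patchE /G.
  case: ifPn => [|] tx.
    rewrite (IH F' Y' x' (fun u => f [tuple of (t : R) :: u]))//; last first.
      apply: (measurableT_comp mf).
      exact: measurable_cons.
    rewrite [LHS]integral_mkcond; apply: eq_integral => w _.
    rewrite /= !patchE; congr (if _ then _ else _).
    apply/idP/idP; rewrite !inE /= => xw.
      by apply/orthant_cons; split=> //; rewrite inE in tx.
    by have /orthant_cons[] := xw.
  apply/esym/integral0_eq => w _; rewrite /= patchE; case: ifPn => //.
  by rewrite inE => /orthant_cons[]; rewrite notin_setE in tx.
Qed.

(** * Independence *)

Lemma integral_mrestr_ge0 {d} {T : measurableType d} {R : realType}
    (mu : {measure set T -> \bar R}) (S : set T) (mS : measurable S)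
    (f : T -> \bar R) :
  measurable_fun setT f -> (forall w, 0 <= f w)%E ->
  (\int[mrestr mu mS]_w f w = \int[mu]_(w in S) f w)%E.
Proof.
move=> mf f0.
have S0 : mrestr mu mS (~` S) = 0%E by rewrite /mrestr setICl measure0.
rewrite (ge0_negligible_integral (measurableC mS) measurableT mf _ S0)//.
rewrite setDE setCK setTI; apply: eq_measure_integral => A mA AS.
by rewrite /= /mrestr setIidl.
Qed.

(** Independence says that [Q] restricted to [S] and [Q] scaled by [Q S] give [Y] the same law. The
    integrals of the positive and negative parts therefore agree. *)
Lemma integral_independent_event {d d0} {T : measurableType d}
    {U : measurableType d0} {R : realType} (Q : probability T R)
    (Y : T -> U) (S : set T) (f : U -> \bar R) :
  measurable_fun setT Y -> measurable S -> measurable_fun setT f ->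
  (forall C, measurable C -> Q (Y @^-1` C `&` S) = Q S * Q (Y @^-1` C))%E ->
  Q.-integrable setT (f \o Y) ->
  (\int[Q]_(w in S) f (Y w) = Q S * \int[Q]_w f (Y w))%E.
Proof.
move=> mY mS mf indep intf.
have ge0 (h : U -> \bar R) : measurable_fun setT h -> (forall u, 0 <= h u)%E ->
    (\int[Q]_(w in S) h (Y w) = Q S * \int[Q]_w h (Y w))%E.
  move=> mh h0.
  have mhY : measurable_fun setT (h \o Y) by exact: measurableT_comp.
  have hY0 w : (0 <= (h \o Y) w)%E by exact: h0.
  pose k := NngNum (fine_ge0 (measure_ge0 Q S)).
  have kE : k%:num%:E = Q S by rewrite /= fineK// fin_num_measure.
  rewrite -kE -(ge0_integral_mscale Q measurableT k mhY (fun w _ => hY0 w)).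
  rewrite -(integral_mrestr_ge0 Q S mS (h \o Y) mhY hY0).
  apply: (eq_law_integral _ _ Y Y h) => // C mC.
  by rewrite /= /mrestr /mscale kE indep.
rewrite [LHS]integralE [X in (_ * X)%E]integralE.
rewrite (muleBr (fin_num_measure Q _ mS) (integrable_add_def measurableT intf)).
have mfp := measurable_funepos mf; have mfn := measurable_funeneg mf.
congr (_ - _)%E.
- under eq_integral do rewrite funepos_comp/=.
  under [in RHS]eq_integral do rewrite funepos_comp/=.
  exact: ge0.
- under eq_integral do rewrite funeneg_comp/=.
  under [in RHS]eq_integral do rewrite funeneg_comp/=.
  exact: ge0.
Qed.

(** A law on the line is determined by its cdf: this is uniqueness on orthants for 1-tuples. *)
Lemma lebesgue_stieltjes_cdfE {d} {T : measurableType d} {R : realType}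
    (P : probability T R) (X : {RV P >-> R})
    (F : cumulativeBounded (0 : R) (1 : R)) (B : set R) :
  (forall x, cdf X x = (F x)%:E) -> measurable B ->
  lebesgue_stieltjes_measure F B = P (X @^-1` B).
Proof.
move=> FX mB.
pose m : probability (measurableTypeR R) R := lebesgue_stieltjes_measure F.
pose Y (t : measurableTypeR R) : 1.-tuple R := [tuple (t : R)].
pose Z (w : T) : 1.-tuple R := [tuple X w].
have mY : measurable_fun setT Y.
  by apply/measurable_fun_tnthP => i; rewrite (ord1 i); exact: measurable_id.
have mZ : measurable_fun setT Z.
  by apply/measurable_fun_tnthP => i; rewrite (ord1 i); exact: measurable_funP.
pose C : set (1.-tuple R) := (fun t => tnth t ord0) @^-1` B.
have mC : measurable C.
  by rewrite -[X in measurable X]setTI; exact: measurable_tnth.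
apply: (charge_orthant_unique (charge_of_finite_measure m)
  (charge_of_finite_measure P) Y Z mY mZ _ _ C mC).
  rewrite /charge_of_finite_measure.
  exact: (etrans (probability_setT m) (esym (probability_setT P))).
move=> x; rewrite /charge_of_finite_measure.
have oE V (W : V -> 1.-tuple R) :
    W @^-1` orthant x = [set v | tnth (W v) ord0 <= tnth x ord0].
  by apply/seteqP; split=> v /= xv => [|i]; rewrite ?(ord1 i).
rewrite !oE; have := FX (tnth x ord0); rewrite -cdf_lebesgue_stieltjes_id.
by rewrite /cdf /distribution /pushforward /= !set_itvE => ->.
Qed.

(** The events with index outside [J] are taken to be the whole line and contribute factors 1. *)
Lemma jointly_independent_sub {d} {T : measurableType d} {R : realType}
    {P : probability T R} {n : nat} (X : 'I_n -> {RV P >-> R})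
    (J K : {set 'I_n}) :
  J \subset K -> jointly_independent X K -> jointly_independent X J.
Proof.
move=> /fintype.subsetP JK indK B mB.
pose B' i := if i \in J then B i else setT.
have mB' i : measurable (B' i) by rewrite /B'; case: ifP.
have -> : [set w | forall i, i \in J -> B i (X i w)] =
    [set w | forall i, i \in K -> B' i (X i w)].
  apply/seteqP; split=> w /= Bw i; rewrite /B'.
    by case: ifPn => [iJ _|//]; exact: Bw.
  by move=> iJ; have := Bw i (JK _ iJ); rewrite /B' iJ.
rewrite indK//.
rewrite (big_setID J)/= [X in (_ * X)%E]big1 ?mule1.
  have -> : K :&: J = J by apply/finset.setIidPr/fintype.subsetP.
  by apply: eq_bigr => i iJ; rewrite /B' iJ.
move=> i; rewrite inE => /andP[/negbTE iJ _].
by rewrite /B' iJ preimage_setT probability_setT.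
Qed.

Lemma jointly_independentU {d} {T : measurableType d} {R : realType}
    {P : probability T R} {n : nat} (X : 'I_n -> {RV P >-> R})
    (A D : {set 'I_n}) (B : 'I_n -> set R) :
  jointly_independent X (A :|: D) -> fintype.disjoint (mem A) (mem D) ->
  (forall i, measurable (B i)) ->
  (P ([set w | forall i, i \in A -> B i (X i w)] `&`
      [set w | forall i, i \in D -> B i (X i w)]) =
   P [set w | forall i, i \in A -> B i (X i w)] *
   P [set w | forall i, i \in D -> B i (X i w)])%E.
Proof.
move=> indAD AD mB.
rewrite (jointly_independent_sub X A _ (finset.subsetUl A D) indAD)//.
rewrite (jointly_independent_sub X D _ (finset.subsetUr A D) indAD)//.
have -> : [set w | forall i, i \in A -> B i (X i w)] `&`
    [set w | forall i, i \in D -> B i (X i w)] =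
    [set w | forall i, i \in A :|: D -> B i (X i w)].
  apply/seteqP; split=> w /=.
    by move=> [BA BD] i; rewrite inE => /orP[|]; [exact: BA|exact: BD].
  by move=> BAD; split=> i iAD; apply: BAD; rewrite inE iAD ?orbT.
rewrite indAD// -bigU//; apply: eq_bigl => i.
by rewrite !inE.
Qed.

(** * Random vectors, rectangles and subvectors *)

Lemma measurable_random_vector {d} {T : measurableType d} {R : realType}
    {P : probability T R} {n : nat} (X : 'I_n -> {RV P >-> R}) :
  measurable_fun setT (random_vector X).
Proof.
apply/measurable_fun_tnthP => i.
have -> : (@tnth n R)^~ i \o random_vector X = X i.
  by apply/funext => w /=; rewrite tnth_mktuple.
exact: measurable_funP.
Qed.

Lemma random_vector_rectangle {d} {T : measurableType d} {R : realType}
    {P : probability T R} {n : nat} (X : 'I_n -> {RV P >-> R})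
    (J : {set 'I_n}) (B : 'I_n -> set R) :
  random_vector X @^-1` [set t | forall i, i \in J -> B i (tnth t i)] =
  [set w | forall i, i \in J -> B i (X i w)].
Proof.
by apply/seteqP; split=> w /= Bw i /Bw; rewrite tnth_mktuple.
Qed.

Lemma measurable_event_rectangle {d} {T : measurableType d} {R : realType}
    {P : probability T R} {n : nat} (X : 'I_n -> {RV P >-> R})
    (J : {set 'I_n}) (B : 'I_n -> set R) :
  (forall i, measurable (B i)) ->
  measurable [set w | forall i, i \in J -> B i (X i w)].
Proof.
move=> mB; rewrite -random_vector_rectangle -[X in measurable X]setTI.
by apply: measurable_random_vector => //; exact: measurable_rectangle.
Qed.

Lemma measurable_subvector {R : realType} {n : nat} (A : {set 'I_n}) :
  measurable_fun setT (@subvector R n A).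
Proof.
apply/measurable_fun_tnthP => k.
have -> : (@tnth _ R)^~ k \o subvector A = (fun t : n.-tuple R => tnth t (enum_val k)).
  by apply/funext => t /=; rewrite tnth_mktuple.
exact: measurable_tnth.
Qed.

Lemma subvector_orthant {R : realType} {n : nat} (A : {set 'I_n})
    (y : #|A|.-tuple R) :
  exists2 B : 'I_n -> set R, (forall i, measurable (B i)) &
    @subvector R n A @^-1` orthant y =
    [set t | forall i, i \in A -> B i (tnth t i)].
Proof.
(* For [i] in [A] exactly one [k] qualifies; for other [i] the empty intersection is the whole
   line. *)
exists (fun i => \bigcap_(k in [set k : 'I_#|A| | enum_val k = i])
  `]-oo, tnth y k]%classic).
  move=> i; apply: fin_bigcap_measurable; first exact: finite_finset.
  by move=> k _; exact: measurable_itv.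
apply/seteqP; split=> t /= yt.
  move=> i iA k /= ki; have := yt k.
  by rewrite tnth_mktuple ki in_itv.
move=> k; have := yt _ (enum_valP k) k erefl.
by rewrite tnth_mktuple /= in_itv.
Qed.

(** * Canonical functions *)

Lemma sigma_of_rectangle {d} {T : measurableType d} {R : realType}
    {P : probability T R} {n : nat} (X : 'I_n -> {RV P >-> R})
    (J K : {set 'I_n}) (B : 'I_n -> set R) :
  J \subset K -> (forall i, measurable (B i)) ->
  sigma_of X K [set w | forall i, i \in J -> B i (X i w)].
Proof.
move=> /fintype.subsetP JK mB.
pose G := \big[setU/set0]_(k < #|K|)
  preimage_set_system setT (X (enum_val k) : T -> R) measurable.
have -> : [set w | forall i, i \in J -> B i (X i w)] =
    \bigcap_(i in [set` J]) (X i @^-1` B i).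
  by apply/seteqP; split=> w /= Bw i; exact: Bw.
apply: (@fin_bigcap_measurable _ (g_sigma_algebraType G)).
  exact: finite_finset.
move=> i /= iJ; apply: sub_sigma_algebra.
have iK := JK _ iJ.
rewrite /G -bigcup_seq; exists (enum_rank_in iK i).
  by rewrite /= mem_index_enum.
by exists (B i) => //; rewrite setTI enum_rankK_in.
Qed.

Lemma canonical_integrable {R : realType} {n : nat}
    {F : 'I_n -> cumulativeBounded (0 : R) (1 : R)} {H : n.-tuple R -> \bar R}
    {d} {T : measurableType d} {Q : probability T R}
    {xi : 'I_n -> {RV Q >-> R}} {g : fun_family R n}
    (hg : canonical_functions F H xi g) (A : {set 'I_n}) :
  (2 <= #|A|)%N ->
  Q.-integrable setT (fun w => (g A (subvector A (random_vector xi w)))%:E).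
Proof.
move=> A2; have /card_gt0P[i iA] : (0 < #|A|)%N by exact: leq_trans A2.
by have [] := canonical_A2 hg A2 iA.
Qed.

(** This is the form in which (A2) is used: the conditional expectation 0 integrated over an event
    of its sigma-algebra. *)
Lemma canonical_integral_sigma {R : realType} {n : nat}
    {F : 'I_n -> cumulativeBounded (0 : R) (1 : R)} {H : n.-tuple R -> \bar R}
    {d} {T : measurableType d} {Q : probability T R}
    {xi : 'I_n -> {RV Q >-> R}} {g : fun_family R n}
    (hg : canonical_functions F H xi g) (A : {set 'I_n}) (i : 'I_n) (S : set T) :
  (2 <= #|A|)%N -> i \in A -> sigma_of xi (A :\ i) S ->
  (\int[Q]_(w in S) (g A (subvector A (random_vector xi w)))%:E = 0)%E.
Proof.
move=> A2 iA sS; have [_ _ _ /(_ S sS) <-] := canonical_A2 hg A2 iA.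
by rewrite integral0_eq.
Qed.

Lemma canonical_measurable {R : realType} {n : nat}
    {F : 'I_n -> cumulativeBounded (0 : R) (1 : R)} {H : n.-tuple R -> \bar R}
    {d} {T : measurableType d} {Q : probability T R}
    {xi : 'I_n -> {RV Q >-> R}} {g : fun_family R n}
    (hg : canonical_functions F H xi g) (A : {set 'I_n}) :
  (2 <= #|A|)%N -> measurable_fun setT (EFin \o g A).
Proof. by move=> A2; apply/measurable_EFinP; exact: (canonical_borel hg). Qed.

(** Fix [i] in [A] outside [J]. The conditions with index in [J :\: A] are independent of the
    subvector on [A] and split off as a factor; those left involve only [A :&: J], which omits [i],
    so (A2) makes the integral vanish. *)
Lemma canonical_integral_not_subset {R : realType} {n : nat}
    {F : 'I_n -> cumulativeBounded (0 : R) (1 : R)} {H : n.-tuple R -> \bar R}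
    {d} {T : measurableType d} {Q : probability T R}
    {xi : 'I_n -> {RV Q >-> R}} {g : fun_family R n}
    (hxi : jointly_independent xi [set: 'I_n]%SET)
    (hg : canonical_functions F H xi g) (A J : {set 'I_n}) (B : 'I_n -> set R) :
  (2 <= #|A|)%N -> ~~ (A \subset J) -> (forall i, measurable (B i)) ->
  (\int[Q]_(w in [set w | forall j, j \in J -> B j (xi j w)])
     (g A (subvector A (random_vector xi w)))%:E = 0)%E.
Proof.
move=> A2 /subsetPn[i iA iJ] mB.
pose V w := subvector A (random_vector xi w).
have mV : measurable_fun setT V.
  exact: (measurableT_comp (measurable_subvector A) (measurable_random_vector xi)).
pose S := [set w | forall j, j \in J :\: A -> B j (xi j w)].
have mS : measurable S by exact: measurable_event_rectangle.
pose C := [set t : #|A|.-tuple R |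
  forall k, k \in [set k | enum_val k \in J]%SET -> B (enum_val k) (tnth t k)].
have mC : measurable C.
  by apply: (measurable_rectangle _ (fun k => B (enum_val k))) => k; exact: mB.
have VC : V @^-1` C = [set w | forall j, j \in A :&: J -> B j (xi j w)].
  apply/seteqP; split=> w /= Cw.
    move=> j; rewrite inE => /andP[jA jJ].
    have := Cw (enum_rank_in jA j).
    by rewrite inE !tnth_mktuple enum_rankK_in//; exact.
  move=> k; rewrite inE => kJ; rewrite !tnth_mktuple; apply: Cw.
  by rewrite inE kJ enum_valP.
have JE : [set w | forall j, j \in J -> B j (xi j w)] = V @^-1` C `&` S.
  rewrite VC; apply/seteqP; split=> w /=.
    by move=> BJ; split=> j; rewrite !inE => /andP[jA jJ]; exact: BJ.
  move=> [BA BD] j jJ; case: (boolP (j \in A)) => jA.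
    by apply: BA; rewrite inE jA.
  by apply: BD; rewrite inE jA.
pose f := (EFin \o g A) \_ C.
have mf : measurable_fun setT f.
  apply/measurable_restrict => //.
  by apply: measurable_funTS; exact: (canonical_measurable hg).
have mVC : measurable (V @^-1` C).
  by rewrite VC; exact: measurable_event_rectangle.
have intg := canonical_integrable hg A A2.
have intf : Q.-integrable setT (f \o V).
  apply: (integrable_mkcond (EFin \o g A \o V) mVC).1.
  exact: (integrableS measurableT mVC _ intg).
(* Both sides are charges in [D], so orthants suffice; there the event is a rectangle and joint
   independence applies. *)
have indep D : measurable D -> (Q (V @^-1` D `&` S) = Q S * Q (V @^-1` D))%E.
  pose q := fine (Q S).
  have qE : q%:E = Q S by rewrite fineK// fin_num_measure.
  rewrite -qE.
  apply: (charge_orthant_unique (crestr (charge_of_finite_measure Q) mS)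
    (cscale q (charge_of_finite_measure Q)) V V mV mV).
    rewrite /= /crestr /cscale /charge_of_finite_measure setTI qE.
    by rewrite -[LHS]mule1; congr (_ * _)%E; exact/esym/(probability_setT Q).
  move=> y; rewrite /= /crestr /cscale /charge_of_finite_measure qE.
  have [BA mBA BAE] := subvector_orthant A y.
  (* One family carries the sides of the orthant on [A] and the given sides on [J :\: A]. *)
  pose B' j := if j \in A then BA j else B j.
  have mB' j : measurable (B' j) by rewrite /B'; case: ifP.
  have -> : V @^-1` orthant y = [set w | forall j, j \in A -> B' j (xi j w)].
    rewrite (_ : V @^-1` orthant y =
      random_vector xi @^-1` (subvector A @^-1` orthant y))// BAE.
    rewrite random_vector_rectangle; apply/seteqP; split=> w /= Bw j jA;
      by have := Bw j jA; rewrite /B' jA.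
  have -> : S = [set w | forall j, j \in J :\: A -> B' j (xi j w)].
    apply/seteqP; split=> w /= Bw j jJA; have := Bw j jJA; rewrite /B';
    by move: jJA; rewrite inE => /andP[/negbTE -> _].
  rewrite muleC; apply: jointly_independentU => //.
    by apply: jointly_independent_sub hxi; exact: finset.subsetT.
  by rewrite -setI_eq0; apply/eqP/setP => j; rewrite !inE; case: (j \in A).
rewrite JE integral_mkcondl.
apply: (etrans (integral_independent_event Q V S f mV mS mf indep intf)).
suff -> : (\int[Q]_w f (V w) = 0)%E by rewrite mule0.
have sC : sigma_of xi (A :\ i) (V @^-1` C).
  rewrite VC; apply: sigma_of_rectangle => //.
  apply/fintype.subsetP => j; rewrite !inE => /andP[-> jJ]; rewrite andbT.
  by apply: contraNneq iJ => <-.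
apply: etrans (canonical_integral_sigma hg A i _ A2 iA sC).
by rewrite [RHS]integral_mkcond.
Qed.

(** * The density 1 + U_n *)

(** The size condition becomes a default 0 in the summand, so that integrability and measurability
    can be checked for each set separately. [V] is the random vector in some uses and the identity
    in another. *)
Lemma canonical_densityE {R : realType} {n : nat} {T : Type}
    (V : T -> n.-tuple R) (g : fun_family R n) :
  (fun w => (1 + canonical_sum g (V w))%:E) =
  (fun w => cst 1 w + \sum_(A : {set 'I_n})
     if (2 <= #|A|)%N then (g A (subvector A (V w)))%:E else 0)%E.
Proof.
apply/funext => w; rewrite EFinD -sumEFin; congr (_ + _)%E.
exact: big_mkcond.
Qed.

Lemma canonical_density_integrable {R : realType} {n : nat}
    {F : 'I_n -> cumulativeBounded (0 : R) (1 : R)} {H : n.-tuple R -> \bar R}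
    {d} {T : measurableType d} {Q : probability T R}
    {xi : 'I_n -> {RV Q >-> R}} {g : fun_family R n}
    (hg : canonical_functions F H xi g) :
  Q.-integrable setT (fun w => (1 + canonical_sum g (random_vector xi w))%:E).
Proof.
rewrite canonical_densityE; apply: integrableD => //.
  exact: finite_measure_integrable_cst.
apply: integrable_sum => // A _; have [A2|A2] := boolP (2 <= #|A|)%N.
  exact: (canonical_integrable hg).
exact: integrable0.
Qed.

Lemma canonical_density_integral {R : realType} {n : nat}
    {F : 'I_n -> cumulativeBounded (0 : R) (1 : R)} {H : n.-tuple R -> \bar R}
    {d} {T : measurableType d} {Q : probability T R}
    {xi : 'I_n -> {RV Q >-> R}} {g : fun_family R n}
    (hg : canonical_functions F H xi g) (S : set T) :
  measurable S ->
  (\int[Q]_(w in S) (1 + canonical_sum g (random_vector xi w))%:E =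
   Q S + \sum_(A : {set 'I_n} | (2 <= #|A|)%N)
     \int[Q]_(w in S) (g A (subvector A (random_vector xi w)))%:E)%E.
Proof.
move=> mS; rewrite canonical_densityE.
have int1 : Q.-integrable S (cst 1%E).
  exact: finite_measure_integrable_cst.
have intA (A : {set 'I_n}) : Q.-integrable S (fun w =>
    if (2 <= #|A|)%N then (g A (subvector A (random_vector xi w)))%:E else 0%E).
  apply: (integrableS measurableT) => //.
  have [A2|A2] := boolP (2 <= #|A|)%N; first exact: (canonical_integrable hg).
  exact: integrable0.
rewrite integralD//; last exact: integrable_sum.
rewrite integral_cst// mul1e integral_sum//; congr (_ + _)%E.
rewrite [RHS]big_mkcond; apply: eq_bigr => A _.
by case: ifP => // _; rewrite integral0.
Qed.

(** Both sides are charges in [C]. They agree on orthants by the representation of the joint cdf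
    together with Fubini. *)
Lemma canonical_density {R : realType} {n : nat}
    {F : 'I_n -> cumulativeBounded (0 : R) (1 : R)}
    {d} {T : measurableType d} {P : probability T R} {X : 'I_n -> {RV P >-> R}}
    {d'} {T' : measurableType d'} {Q : probability T' R}
    {xi : 'I_n -> {RV Q >-> R}} {g : fun_family R n}
    (hF : forall i x, cdf (xi i) x = (F i x)%:E)
    (hxi : jointly_independent xi [set: 'I_n]%SET)
    (hg : canonical_functions F (joint_cdf X) xi g) (C : set (n.-tuple R)) :
  measurable C ->
  (P (random_vector X @^-1` C) = \int[Q]_(w in random_vector xi @^-1` C)
     (1 + canonical_sum g (random_vector xi w))%:E)%E.
Proof.
have intU := canonical_density_integrable hg.
have mX := measurable_random_vector X.
have mV := measurable_random_vector xi.
move: C; apply: (charge_orthant_unique (charge_of_finite_measure P)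
  (induced_charge intU) _ _ mX mV).
  rewrite /= /charge_of_finite_measure /induced_charge.
  rewrite (canonical_density_integral hg setT measurableT).
  (* Both total masses are 1: the whole space lies in every sigma-algebra of (A2), so each canonical
     function has mean 0. *)
  rewrite big1 ?adde0.
    exact: etrans (probability_setT P) (esym (probability_setT Q)).
  move=> A A2; have /card_gt0P[i iA] : (0 < #|A|)%N by exact: leq_trans A2.
  by apply: (canonical_integral_sigma hg A i) => //; exact: (@measurableT _ (g_sigma_algebraType _)).
move=> x; rewrite /= /charge_of_finite_measure /induced_charge.
have -> : random_vector X @^-1` orthant x =
    [set w | forall i, X i w <= tnth x i].
  by apply/seteqP; split=> w /= xw i; have := xw i; rewrite tnth_mktuple.
apply: (etrans (canonical_representation hg x)).
apply: (iterated_integral_independent Q F (random_vector xi) x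
  (fun t => (1 + canonical_sum g t)%:E)) => //.
- move=> B mB; have := hxi B mB.
  under eq_bigl do rewrite finset.in_setT.
  under eq_bigr do rewrite -(lebesgue_stieltjes_cdfE Q _ _ _ (hF _) (mB _)).
  move=> <-; congr (Q _); apply/seteqP; split=> w /= Bw i.
    by have := Bw i; rewrite tnth_mktuple.
  by rewrite tnth_mktuple; apply: Bw; rewrite finset.in_setT.
- rewrite (canonical_densityE id); apply: emeasurable_funD => //.
  apply: emeasurable_sum => A; have [A2|A2] := boolP (2 <= #|A|)%N => //.
  exact: measurableT_comp (canonical_measurable hg A A2) (measurable_subvector A).
Qed.

(** Integrating the density over the rectangle leaves only the sets inside [J]. The constant 1
    yields the product of marginals, since [X i] and [xi i] share the cdf [F i]. *)
Lemma rectangle_probability {R : realType} {n : nat}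
    {F : 'I_n -> cumulativeBounded (0 : R) (1 : R)}
    {d} {T : measurableType d} {P : probability T R} {X : 'I_n -> {RV P >-> R}}
    {d'} {T' : measurableType d'} {Q : probability T' R}
    {xi : 'I_n -> {RV Q >-> R}} {g : fun_family R n}
    (hX : forall i x, cdf (X i) x = (F i x)%:E)
    (hF : forall i x, cdf (xi i) x = (F i x)%:E)
    (hxi : jointly_independent xi [set: 'I_n]%SET)
    (hg : canonical_functions F (joint_cdf X) xi g)
    (J : {set 'I_n}) (B : 'I_n -> set R) :
  (forall i, measurable (B i)) ->
  (P [set w | forall i, i \in J -> B i (X i w)] =
   \prod_(i in J) P (X i @^-1` B i) +
   \sum_(A : {set 'I_n} | (2 <= #|A|)%N && (A \subset J))
     \int[Q]_(w in [set w | forall i, i \in J -> B i (xi i w)])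
       (g A (subvector A (random_vector xi w)))%:E)%E.
Proof.
move=> mB; rewrite -random_vector_rectangle.
rewrite (canonical_density hF hxi hg) ?random_vector_rectangle; last first.
  exact: measurable_rectangle.
rewrite (canonical_density_integral hg); last exact: measurable_event_rectangle.
congr (_ + _)%E.
  rewrite (jointly_independent_sub xi J _ (finset.subsetT _) hxi)//.
  apply: eq_bigr => i _.
  by rewrite -(lebesgue_stieltjes_cdfE Q _ _ _ (hF i) (mB i))
    -(lebesgue_stieltjes_cdfE P _ _ _ (hX i) (mB i)).
rewrite (bigID (fun A : {set 'I_n} => A \subset J))/= [X in (_ + X)%E]big1 ?adde0//.
by move=> A /andP[A2 AJ]; exact: (canonical_integral_not_subset hxi hg).
Qed.

(** Preimages of orthants under the subvector map are rectangles, so the charge with density [g A]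
    is compared with the zero charge and vanishes on all events determined by the subvector, in
    particular on those where [g A] has constant sign. *)
Lemma canonical_eq0 {R : realType} {n : nat}
    {F : 'I_n -> cumulativeBounded (0 : R) (1 : R)} {H : n.-tuple R -> \bar R}
    {d} {T : measurableType d} {Q : probability T R}
    {xi : 'I_n -> {RV Q >-> R}} {g : fun_family R n}
    (hg : canonical_functions F H xi g) (A : {set 'I_n}) :
  (2 <= #|A|)%N ->
  (forall B : 'I_n -> set R, (forall i, measurable (B i)) ->
    \int[Q]_(w in [set w | forall i, i \in A -> B i (xi i w)])
       (g A (subvector A (random_vector xi w)))%:E = 0)%E ->
  {ae Q, forall w, g A (subvector A (random_vector xi w)) = 0}.
Proof.
move=> A2 int0.
pose V w := subvector A (random_vector xi w).
have mV : measurable_fun setT V.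
  exact: (measurableT_comp (measurable_subvector A) (measurable_random_vector xi)).
have intg := canonical_integrable hg A A2.
have mg := canonical_measurable hg A A2.
have intC C : measurable C -> (\int[Q]_(w in V @^-1` C) (g A (V w))%:E = 0)%E.
  apply: (charge_orthant_unique (induced_charge intg)
    (czero : {charge set T -> \bar R}) V V mV mV).
    rewrite /= /induced_charge /czero.
    have := int0 (fun=> setT) (fun=> measurableT); congr (_ = _).
    by congr (integral _ _ _); apply/seteqP.
  move=> y; rewrite /= /induced_charge /czero.
  have [B mB BE] := subvector_orthant A y.
  rewrite -(int0 B mB); congr (integral _ _ _).
  by rewrite -random_vector_rectangle -BE.
(* On [C] the absolute value is [g A], off [C] it is its opposite; both pieces integrate to 0, hence
   so does the absolute value. *)
pose C := g A @^-1` `[0, +oo[%classic.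
have mC : measurable C.
  rewrite -[X in measurable X]setTI.
  by apply: (canonical_borel hg) => //; exact: measurable_itv.
have mVC D : measurable D -> measurable (V @^-1` D).
  by move=> mD; rewrite -[X in measurable X]setTI; exact: mV.
have mgV := measurable_int _ intg.
have mabs : measurable_fun setT (fun w => `|(g A (V w))%:E|%E).
  exact: measurableT_comp mgV.
have dC : [disjoint V @^-1` C & ~` (V @^-1` C)].
  by apply/disj_set2P; rewrite setICr.
have abs0 : (\int[Q]_w `|(g A (V w))%:E| = 0)%E.
  rewrite -(setUv (V @^-1` C)) (ge0_integral_setU Q (mVC C mC)
    (measurableC (mVC C mC)) (measurable_funTS mabs) _ dC)//.
  rewrite -[RHS]adde0; congr (_ + _)%E.
    rewrite -[RHS](intC C mC); apply: eq_integral => w.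
    by rewrite inE /C /= in_itv /= andbT => g0; rewrite ger0_norm.
  have := intC (~` C) (measurableC mC); rewrite preimage_setC => intN.
  rewrite -[RHS]oppe0 -[in RHS]intN -integralN.
    apply: eq_integral => w.
    rewrite inE /C /= in_itv /= andbT => /negP; rewrite -ltNge => g0.
    by rewrite ltr0_norm.
  have mNC := measurableC (mVC C mC).
  exact: (integrable_add_def mNC (integrableS measurableT mNC (@subsetT _ _) intg)).
have := (ae_eq_integral_abs Q measurableT mgV).1 abs0.
by apply: filterS => w /= /(_ I) [].
Qed.

(** * The criterion for r-independence *)

(** r-independence speaks of index sets of size exactly [r]; smaller sets are reached by enlarging
    them one element at a time. *)
Lemma exists_superset_of_card {T : finType} (A : {set T}) (r : nat) :
  (#|A| <= r <= #|T|)%N -> exists2 J : {set T}, A \subset J & #|J| = r.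
Proof.
have [k] := ubnP (r - #|A|); elim: k A => // k IH A rA /andP[Ar rT].
have [Ar'|neAr] := eqVneq #|A| r; first by exists A.
have ltAr : (#|A| < r)%N by rewrite ltn_neqAle neAr.
have /card_gt0P[x] : (0 < #|~: A|)%N.
  by rewrite -(ltn_add2l #|A|) cardsC addn0 (leq_trans ltAr).
rewrite finset.in_setC => xA.
have [A' AA' cA'] : exists2 A' : {set T}, A \subset A' & #|A'| = #|A|.+1.
  by exists (x |: A); [exact: finset.subsetUr|rewrite cardsU1 xA].
case: (IH A') => [||J AJ Jr]; rewrite ?cA' ?ltAr//.
  by rewrite subnS -ltnS prednK// subn_gt0.
by exists J => //; exact: fintype.subset_trans AJ.
Qed.

Theorem theorem5p8 (R : realType) (n r : nat) (hr : (2 <= r < n)%N)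
  (F : 'I_n -> cumulativeBounded (0 : R) (1 : R))
  (d : measure_display) (T : measurableType d) (P : probability T R)
  (X : 'I_n -> {RV P >-> R})
  (hX : forall i x, cdf (X i) x = (F i x)%:E)
  (hac : abs_continuous_cdf F (joint_cdf X))
  (d' : measure_display) (T' : measurableType d') (Q : probability T' R)
  (xi : 'I_n -> {RV Q >-> R})
  (hxi : forall i x, cdf (xi i) x = (F i x)%:E)
  (hxi_indep : jointly_independent xi [set: 'I_n]%SET)
  (g : fun_family R n)
  (hg : canonical_functions F (joint_cdf X) xi g) :
  r_independent X r <->
  forall A : {set 'I_n}, (2 <= #|A| <= r)%N ->
    {ae Q, forall w, g A (subvector A (random_vector xi w)) = 0}.
Proof.
(* First the sufficiency: a set inside [J] has at most [r] elements, so every correction term in the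
   expansion for [J] is 0. *)
case/andP: hr => r2 rn; split=> [indX A|g0 J Jr B mB]; last first.
  rewrite (rectangle_probability hX hxi hxi_indep hg J B mB).
  rewrite [X in (_ + X)%E]big1 ?adde0// => A /andP[A2 AJ].
  have mS := measurable_event_rectangle xi J B mB.
  have intg := canonical_integrable hg A A2.
  rewrite (ae_eq_integral (cst 0%E))//.
  - by rewrite integral0.
  - exact: (measurable_funTS (measurable_int _ intg)).
  - have /g0 : (2 <= #|A| <= r)%N by rewrite A2 -Jr subset_leq_card.
    by apply: filterS => w /= -> _.
(* Necessity, by strong induction on the size of [A]. *)
have [m] := ubnP #|A|; elim: m A => // m IH A Am /andP[A2 Ar].
apply: (canonical_eq0 hg A A2) => B mB.
have [J AJ Jr] : exists2 J : {set 'I_n}, A \subset J & #|J| = r.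
  by apply: exists_superset_of_card; rewrite Ar card_ord ltnW.
have := jointly_independent_sub X A J AJ (indX J Jr) B mB.
rewrite (rectangle_probability hX hxi hxi_indep hg A B mB).
(* The term of [A] is isolated; proper subsets contribute 0 by the induction hypothesis. *)
rewrite (bigD1 A)/=; last by rewrite A2 subxx.
rewrite [X in (_ + (_ + X))%E]big1 ?adde0 => [|A' /andP[/andP[A'2 A'A] A'neA]].
  set p := (\prod_(i in A) P (X i @^-1` B i))%E => indA.
  (* Finiteness of [p] allows it to be cancelled in the extended reals, leaving the integral of
     [g A] equal to 0. *)
  have pfin : p \is a fin_num.
    rewrite /p -(jointly_independent_sub X A J AJ (indX J Jr) B mB).
    by rewrite fin_num_measure//; exact: measurable_event_rectangle.
  by rewrite -(subee pfin) -{1}indA addeC addeA (addeC (- p)%E) subee// add0e.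
have mS := measurable_event_rectangle xi A B mB.
have intg := canonical_integrable hg A' A'2.
rewrite (ae_eq_integral (cst 0%E))//.
- by rewrite integral0.
- exact: (measurable_funTS (measurable_int _ intg)).
- have A'ltA : (#|A'| < #|A|)%N by rewrite proper_card// finset.properEneq A'neA.
  have /IH : (#|A'| < m)%N by exact: leq_trans A'ltA _.
  rewrite A'2 (leq_trans (ltnW A'ltA) Ar) => /(_ isT).
  by apply: filterS => w /= -> _.
Qed.
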